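(* Let $0<r<1$ and let $1\le p<\infty$ with $p\neq 2$. Then the space $t_p^r$, with its norm $\|\cdot\|_{t_p^r}$, is not an inner product space (that is, its norm is not induced by an inner product), and hence it is not a Hilbert space.
   Context: Let $\mathbb{N}=\{0,1,2,\dots\}$ and let $\omega$ be the linear space of all (real or complex) sequences $x=(x_k)_{k\in\mathbb{N}}$. For $0<r<1$ the Taylor transform $T(r)x$ of $x\in\omega$ is the sequence with terms $$(T(r)x)_n=\sum_{k=n}^{\infty}\binom{k}{n}(1-r)^{n+1}r^{k-n}x_k\qquad(n\in\mathbb{N}),$$ whenever all these series converge. For $1\le p<\infty$ let $$t_p^r=\Big\{x\in\omega:\ \sum_{n}\Big|\sum_{k=n}^{\infty}\binom{k}{n}(1-r)^{n+1}r^{k-n}x_k\Big|^p<\infty\Big\},$$ a linear space under coordinatewise operations, equipped with $\|x\|_{t_p^r}=\|T(r)x\|_{\ell_p}$. *)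

(* Defs.v *)
From HB Require Import structures.
From mathcomp Require Import all_boot all_order all_algebra.
From mathcomp Require Import all_classical all_reals all_analysis.
From mathcomp Require Import complex.
Set Implicit Arguments.
Unset Strict Implicit.
Unset Printing Implicit Defensive.
Import Order.TTheory GRing.Theory Num.Theory.
Import numFieldNormedType.Exports.
Local Open Scope classical_set_scope.
Local Open Scope ring_scope.

(* The sequences may be real or complex: [ground] selects which. *)
Variant ground := RealGround | ComplexGround.

Section Scalars.
Variable R : realType.

Definition scalar_field (F : ground) : numFieldType :=
  match F with
  | RealGround => [the numFieldType of R : Type]
  | ComplexGround => [the numFieldType of R[i] : Type]
  end.

Definition of_real (F : ground) : R -> scalar_field F :=
  match F with
  | RealGround => fun a => a
  | ComplexGround => fun a => (a%:C)%C
  end.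

Definition scalar_re (F : ground) : scalar_field F -> R :=
  match F with
  | RealGround => fun a => a
  | ComplexGround => fun z : R[i] => complex.Re z
  end.

Definition scalar_conj (F : ground) : scalar_field F -> scalar_field F :=
  match F with
  | RealGround => fun a => a
  | ComplexGround => fun z : R[i] => (z^*)%C
  end.

(* The norm of a numFieldType takes its values in the field itself; this is
   the same absolute value, seen in R. *)
Definition modulus (F : ground) (z : scalar_field F) : R := scalar_re `|z|.

End Scalars.

Section ScalarLemmas.
Variables (R : realType) (F : ground).
Implicit Types x y : scalar_field R F.

Lemma modulus_ge0 x : 0 <= modulus x.
Proof.
rewrite /modulus; case: F x => x; first exact: normr_ge0.
by have := normr_ge0 x; rewrite lecE => /andP[].
Qed.

Lemma ler_modulusD x y : modulus (x + y) <= modulus x + modulus y.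
Proof.
rewrite /modulus; case: F x y => x y; first exact: ler_normD.
by have := ler_normD x y; rewrite lecE => /andP[_] /le_trans; apply; case: `|x|; case: `|y|.
Qed.

Lemma modulusM x y : modulus (x * y) = modulus x * modulus y.
Proof.
rewrite /modulus; case: F x y => x y; first exact: normrM.
have xy : `|(x : R[i]) * (y : R[i])| = `|x : R[i]| * `|y : R[i]| by exact: normrM.
apply: etrans (congr1 (@complex.Re R) xy) _.
by change (complex.Re (`|x : R[i]| * `|y : R[i]|) =
  complex.Re `|x : R[i]| * complex.Re `|y : R[i]|); rewrite !normc_def -rmorphM.
Qed.

Lemma modulus0 : modulus (0 : scalar_field R F) = 0.
Proof. by rewrite /modulus; case: F; rewrite normr0. Qed.

End ScalarLemmas.

Section TaylorTransform.
Variables (R : realType) (F : ground) (r : R).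
Local Notation K := (scalar_field R F).

Definition taylor_term (n : nat) (x : nat -> K^o) (k : nat) : K^o :=
  of_real F ('C(k, n)%:R * (1 - r) ^+ n.+1 * r ^+ (k - n)) * x k.

Definition taylor_defined (x : nat -> K^o) : Prop :=
  forall n, cvgn (fun m => \sum_(n <= k < m) taylor_term n x k).

(* Only meaningful when [taylor_defined x]. *)
Definition taylor (x : nat -> K^o) (n : nat) : K^o :=
  limn (fun m => \sum_(n <= k < m) taylor_term n x k).

Definition in_taylor_space (p : R) (x : nat -> K^o) : Prop :=
  taylor_defined x /\
  (\sum_(0 <= n <oo) (modulus (taylor x n) `^ p)%:E < +oo)%E.

Let termD n x y k :
  taylor_term n (x + y) k = taylor_term n x k + taylor_term n y k.
Proof. by rewrite /taylor_term mulrDr. Qed.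

Let termZ n a x k : taylor_term n (a *: x) k = a *: taylor_term n x k.
Proof. by rewrite /taylor_term /= mulrCA. Qed.

Let sumD n x y : (fun m => \sum_(n <= k < m) taylor_term n (x + y) k) =
  (fun m => \sum_(n <= k < m) taylor_term n x k) +
  (fun m => \sum_(n <= k < m) taylor_term n y k).
Proof.
apply/funext => m; apply: etrans (big_split _ _ _ _ _) => /=.
by apply: eq_bigr => k _; exact: termD.
Qed.

Let sumZ n a x : (fun m => \sum_(n <= k < m) taylor_term n (a *: x) k) =
  a *: (fun m => \sum_(n <= k < m) taylor_term n x k).
Proof.
apply/funext => m; apply: etrans (esym (scaler_sumr _ _ _ _)) => /=.
by apply: eq_bigr => k _; exact: termZ.
Qed.

Lemma taylor_definedD x y :
  taylor_defined x -> taylor_defined y -> taylor_defined (x + y).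
Proof. by move=> dx dy n; rewrite sumD; exact: is_cvgD (dx n) (dy n). Qed.

Lemma taylor_definedZ a x : taylor_defined x -> taylor_defined (a *: x).
Proof. by move=> dx n; rewrite sumZ; exact: is_cvgZl_tmp (dx n). Qed.

Lemma taylorD x y : taylor_defined x -> taylor_defined y ->
  taylor (x + y) = taylor x + taylor y.
Proof.
by move=> dx dy; apply/funext => n; rewrite /taylor sumD; exact: limD (dx n) (dy n).
Qed.

Lemma taylorZ a x : taylor_defined x -> taylor (a *: x) = a *: taylor x.
Proof.
by move=> dx; apply/funext => n; rewrite /taylor sumZ; exact: limZl_tmp (dx n).
Qed.

Lemma taylor_defined0 : taylor_defined 0.
Proof.
move=> n; rewrite (_ : (fun _ => _) = cst 0); first exact: is_cvg_cst.
by apply/funext => m; rewrite big1// => k _; rewrite /taylor_term mulr0.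
Qed.

Lemma taylor0 : taylor 0 = 0.
Proof. by rewrite -(scale0r (0 : nat -> K^o)) taylorZ ?scale0r//; exact: taylor_defined0. Qed.

Lemma in_taylor_spaceD (p : R) x y : 0 <= p ->
  in_taylor_space p x -> in_taylor_space p y -> in_taylor_space p (x + y).
Proof.
move=> p0 [dx sx] [dy sy]; split; first exact: taylor_definedD.
rewrite (taylorD dx dy).
have ge0 z n : (0 <= (modulus (taylor z n) `^ p)%:E)%E by rewrite lee_fin powR_ge0.
pose g n : \bar R := ((2 `^ p)%:E *
  ((modulus (taylor x n) `^ p)%:E + (modulus (taylor y n) `^ p)%:E))%E.
apply: (@le_lt_trans _ _ (\sum_(0 <= n <oo) g n)%E).
  apply: lee_nneseries => [n _ _|n _]; first by rewrite lee_fin powR_ge0.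
  rewrite /g -EFinD -EFinM lee_fin.
  have := ler_modulusD (taylor x n) (taylor y n).
  have := modulus_ge0 (taylor x n); have := modulus_ge0 (taylor y n).
  have := modulus_ge0 (taylor x n + taylor y n).
  move: (modulus (_ + _)) (modulus (taylor x n)) (modulus (taylor y n)) => c a b c0 b0 a0 cab.
  apply: (@le_trans _ _ ((2 * Num.max a b) `^ p)).
    apply: ge0_ler_powR; rewrite // ?nnegrE//.
      by rewrite mulr_ge0// le_max a0.
    apply: le_trans cab _.
    by rewrite mulr_natl mulr2n lerD// le_max lexx ?orbT.
  rewrite powRM// ?le_max ?a0// ler_wpM2l ?powR_ge0//.
  have ap : 0 <= a `^ p by exact: powR_ge0.
  have bp : 0 <= b `^ p by exact: powR_ge0.
  by case: (leP a b) => _; [rewrite lerDr|rewrite lerDl].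
rewrite nneseriesZl; last by move=> n _; rewrite adde_ge0.
rewrite nneseriesD; [|by move=> *; exact: ge0..].
apply: lte_mul_pinfty => //; exact: (lte_add_pinfty sx sy).
Qed.

Lemma in_taylor_spaceZ (p : R) a x :
  in_taylor_space p x -> in_taylor_space p (a *: x).
Proof.
move=> [dx sx]; split; first exact: taylor_definedZ.
rewrite (taylorZ a dx).
under eq_eseriesr => n _ do
  rewrite fctE modulusM powRM ?modulus_ge0// EFinM.
rewrite nneseriesZl; last by move=> n _; rewrite lee_fin powR_ge0.
by apply: (lte_mul_pinfty _ _ sx) => //; rewrite lee_fin powR_ge0.
Qed.

Lemma in_taylor_space0 (p : R) : p != 0 -> in_taylor_space p 0.
Proof.
move=> p0; split; first exact: taylor_defined0.
by rewrite taylor0 eseries0 ?ltry// => n _ _; rewrite modulus0 powR0.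
Qed.

End TaylorTransform.

Section TaylorSpace.
Variables (R : realType) (F : ground) (r p : R) (p1 : 1 <= p).
Local Notation K := (scalar_field R F).

(* The hypothesis 1 <= p occurs in the type of the space only so that the space
   is canonically an lmodType, as for LfunType. *)
Definition taylor_space_pred (_ : 1 <= p) : {pred (nat -> K^o)} :=
  fun x => `[< in_taylor_space r p x >].

Record taylor_space := TaylorSpace {
  taylor_seq :> nat -> K^o;
  taylor_seqP : taylor_seq \in taylor_space_pred p1 }.

HB.instance Definition _ := [isSub for taylor_seq].
HB.instance Definition _ := [Choice of taylor_space by <:].

Lemma taylor_space_submod_closed : submod_closed (taylor_space_pred p1).
Proof.
have p0 : 0 < p by exact: lt_le_trans p1.
split=> [|a x y /asboolP sx /asboolP sy]; apply/asboolP.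
  by apply: in_taylor_space0; rewrite gt_eqF.
by apply: in_taylor_spaceD (ltW p0) _ sy; exact: in_taylor_spaceZ.
Qed.

HB.instance Definition _ := GRing.isSubmodClosed.Build K (nat -> K^o)
  (taylor_space_pred p1) taylor_space_submod_closed.
HB.instance Definition _ := [SubChoice_isSubLmodule of taylor_space by <:].

(* The Lp-norm for the counting measure on nat is the norm of l_p. *)
Definition taylor_norm (x : taylor_space) : R :=
  fine ('N[counting]_(p%:E)[(fun n => (modulus (taylor r x n))%:E)])%E.

End TaylorSpace.
Arguments taylor_space {R} F r {p} p1.
Arguments taylor_norm {R} F r {p} p1 x.

Section InnerProduct.
Variables (R : realType) (F : ground) (V : lmodType (scalar_field R F)).

Definition inner_product_space (N : V -> R) : Prop :=
  exists f : {dot V for @scalar_conj R F}, forall x, N x = Num.sqrt (scalar_re (f x x)).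

(* [taylor_norm] is not registered as a norm of the library, hence the explicit
   form of completeness. *)
Definition complete_norm (N : V -> R) : Prop :=
  forall u : nat -> V,
    (forall e : R, 0 < e ->
       exists n0, forall m n, (n0 <= m)%N -> (n0 <= n)%N -> N (u m - u n) < e) ->
    exists l : V, (fun n => N (u n - l)) @ \oo --> (0 : R).

Definition hilbert_space (N : V -> R) : Prop :=
  inner_product_space N /\ complete_norm N.

End InnerProduct.

(* Main.v *)
Require Import Defs.
From HB Require Import structures.
From mathcomp Require Import all_boot all_order all_algebra.
From mathcomp Require Import all_classical all_reals all_analysis.
From mathcomp Require Import complex ring lra.
Import Order.TTheory GRing.Theory Num.Theory.
Import numFieldNormedType.Exports.
Local Open Scope classical_set_scope.
Local Open Scope ring_scope.

(** A norm that comes from an inner product satisfies the parallelogram law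
    ([parallelogram_law]).  On sequences supported on {0, 1} the Taylor
    transform is the triangular map
      (a, b) |-> ((1 - r) a + (1 - r) r b, (1 - r)^2 b),
    which is invertible as r <> 1.  Hence the Taylor space contains, for all
    reals u and v, a sequence [witness u v] with transform (u, v, 0, 0, ...);
    it depends additively on (u, v) and has norm (|u|^p + |v|^p)^(1/p)
    ([norm_witness]).  The Taylor space thus contains an isometric copy of the
    two-dimensional l_p, where the parallelogram law for (1, 0) and (0, 1) reads
    2 * 2^(2/p) = 4, and this forces p = 2. *)

Section RealScalars.
Variables (R : realType) (F : ground).
Local Notation K := (scalar_field R F).

Lemma of_real_is_zmod_morphism : zmod_morphism (of_real (R := R) F).
Proof. by case: F => a b //=; exact: (rmorphB (real_complex R)). Qed.

HB.instance Definition _ :=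
  GRing.isZmodMorphism.Build R K (of_real F) of_real_is_zmod_morphism.

Lemma of_realM (a b : R) : of_real F (a * b) = of_real F a * of_real F b.
Proof. by case: F => //=; exact: (rmorphM (real_complex R)). Qed.

Lemma modulus_of_real (a : R) : modulus (of_real F a) = `|a|.
Proof.
rewrite /modulus; case: F => //=.
change (complex.Re `|(a%:C)%C : R[i]| = `|a|).
by rewrite normc_def /= expr0n addr0 sqrtr_sqr.
Qed.

Lemma scalar_reD (a b : K) : scalar_re (a + b) = scalar_re a + scalar_re b.
Proof. by case: F a b => //= -[a a'] [b b']. Qed.

Lemma scalar_re_ge0 (a : K) : 0 <= a -> 0 <= scalar_re a.
Proof. by case: F a => //= a; rewrite lecE => /andP[]. Qed.

End RealScalars.

Lemma parallelogram_law (R : realType) (F : ground)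
    (V : lmodType (scalar_field R F)) (N : V -> R) :
  inner_product_space N ->
  forall x y, N (x + y) ^+ 2 + N (x - y) ^+ 2 = 2 * (N x ^+ 2 + N y ^+ 2).
Proof.
move=> [f Nf] x y.
have N2 z : N z ^+ 2 = scalar_re (f z z).
  rewrite Nf sqr_sqrtr//; apply: scalar_re_ge0.
  have [->|z0] := eqVneq z 0; first by rewrite linear0r.
  exact/ltW/neq0_dnorm_gt0.
rewrite !N2 -!scalar_reD.
have -> : f (x + y) (x + y) + f (x - y) (x - y) =
    (f x x + f y y) + (f x x + f y y).
  rewrite !(linearDl, linearNl) !(linearDr, linearNr).
  by ring.
by rewrite !scalar_reD; ring.
Qed.

Section FiniteSupport.
Variables (R : realType) (F : ground) (r : R).
Local Notation K := (scalar_field R F).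

Lemma finite_taylor_cvg (x : nat -> K^o) (m n : nat) :
  (forall k, (m <= k)%N -> x k = 0) ->
  (fun j => \sum_(n <= k < j) taylor_term r n x k) @ \oo -->
    (\sum_(n <= k < m) taylor_term r n x k : K^o).
Proof.
move=> x0; apply: cvg_near_cst; near=> j.
have mj : (m <= j)%N by near: j; exact: nbhs_infty_ge.
have tail0 i : (m <= i)%N -> \sum_(i <= k < j) taylor_term r n x k = 0.
  move=> mi; rewrite big_nat big1// => k /andP[ik _].
  by rewrite /taylor_term x0 ?mulr0// (leq_trans mi).
have [nm|mn] := leqP n m.
  by rewrite (big_cat_nat nm mj) /= tail0// addr0.
by rewrite [RHS]big_geq ?(ltnW mn)// tail0// ltnW.
Unshelve. all: by end_near.
Qed.

Lemma finite_modulus_series (p : R) (y : nat -> K^o) (m : nat) : p != 0 ->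
  (forall n, (m <= n)%N -> y n = 0) ->
  (\sum_(0 <= n <oo) (modulus (y n) `^ p)%:E)%E =
    (\sum_(0 <= n < m) modulus (y n) `^ p)%:E.
Proof.
move=> p0 y0.
rewrite (nneseries_split 0 m); last by move=> n _; rewrite lee_fin powR_ge0.
by rewrite add0n eseries0 ?adde0 ?sumEFin// => n mn _; rewrite y0// modulus0 powR0.
Qed.

Lemma taylor_norm_finite (p : R) (p1 : 1 <= p) (x : taylor_space F r p1) m :
  (forall n, (m <= n)%N -> taylor r x n = 0) ->
  taylor_norm F r p1 x =
    (\sum_(0 <= n < m) modulus (taylor r x n) `^ p) `^ p^-1.
Proof.
move=> x0; have p0 : 0 < p by exact: (lt_le_trans ltr01 p1).
rewrite /taylor_norm Lnorm_counting// fine_poweR.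
under eq_eseriesr => n _ do
  rewrite abse_EFin ger0_norm ?modulus_ge0// poweR_EFin.
by rewrite (finite_modulus_series p _ m) ?gt_eqF.
Qed.

End FiniteSupport.

Section Witness.
Variables (R : realType) (F : ground) (r p : R) (p1 : 1 <= p) (r1 : r < 1).
Local Notation K := (scalar_field R F).

(** The preimage of (u, v, 0, 0, ...), from solving the triangular system
    (1 - r) a + (1 - r) r b = u and (1 - r)^2 b = v. *)
Definition witness_seq (u v : R) (k : nat) : K^o :=
  of_real F (match k with
    | 0 => u / (1 - r) - r * v / (1 - r) ^+ 2
    | 1 => v / (1 - r) ^+ 2
    | _ => 0
    end).

Let witness_supp u v k : (2 <= k)%N -> witness_seq u v k = 0.
Proof. by case: k => [|[|k]] // _; exact: raddf0. Qed.

Lemma taylor_witness u v n : taylor r (witness_seq u v) n =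
  of_real F (match n with 0 => u | 1 => v | _ => 0 end).
Proof.
have r0 : 1 - r != 0 by rewrite subr_eq0 gt_eqF.
rewrite /taylor (cvg_lim _ (finite_taylor_cvg R F r _ 2 n (witness_supp u v)))//.
rewrite /taylor_term /witness_seq.
under eq_bigr => k _ do rewrite -of_realM.
rewrite -raddf_sum; congr of_real; case: n => [|[|n]].
- rewrite big_nat_recl// big_nat1 /= !bin0; field.
  exact: r0.
- rewrite big_nat1 /= binn; field.
  exact: r0.
- by rewrite big_geq.
Qed.

Lemma witness_in_space u v : witness_seq u v \in taylor_space_pred (F := F) r p1.
Proof.
apply/asboolP; split=> [n|].
  exact: cvgP (finite_taylor_cvg R F r _ 2 n (witness_supp u v)).
rewrite (finite_modulus_series R F p _ 2) ?ltry//.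
  by rewrite gt_eqF// (lt_le_trans ltr01 p1).
by move=> [|[|n]] // _; rewrite taylor_witness raddf0.
Qed.

Definition witness u v : taylor_space F r p1 := TaylorSpace (witness_in_space u v).

Lemma witnessD u v u' v' :
  witness u v + witness u' v' = witness (u + u') (v + v').
Proof.
apply: val_inj; rewrite raddfD; apply/funext => k /=.
rewrite fctE /witness_seq -raddfD; congr of_real.
by case: k => [|[|k]]; ring.
Qed.

Lemma witnessB u v u' v' :
  witness u v - witness u' v' = witness (u - u') (v - v').
Proof. by apply/eqP; rewrite subr_eq witnessD !subrK. Qed.

Lemma norm_witness u v :
  taylor_norm F r p1 (witness u v) = (`|u| `^ p + `|v| `^ p) `^ p^-1.
Proof.
rewrite (taylor_norm_finite R F r p p1 _ 2); last first.
  by move=> [|[|n]] // _; rewrite taylor_witness raddf0.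
by rewrite big_nat_recl// big_nat1 !taylor_witness !modulus_of_real.
Qed.

End Witness.

Lemma powR2_inv_sqr_eq2 (R : realType) (p : R) : 0 < p ->
  (2 `^ p^-1) ^+ 2 = 2 -> p = 2.
Proof.
move=> p0 /(congr1 (@ln R)); rewrite lnXn ?powR_gt0// ln_powR => h.
have l2 : ln (2 : R) != 0 by rewrite gt_eqF// ln_gt0// ltr1n.
have /(mulIf l2) : (2 / p) * ln 2 = 1 * ln 2 :> R.
  by rewrite mul1r -[RHS]h -mulrA mulr_natl.
by move/divr1_eq.
Qed.

Theorem theorem2p1 (R : realType) (F : ground) (r p : R) (p1 : 1 <= p) :
  0 < r < 1 -> p != 2 ->
  ~ inner_product_space (taylor_norm F r p1) /\
  ~ hilbert_space (taylor_norm F r p1).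
Proof.
move=> /andP[_ r1] p2.
suff nip : ~ inner_product_space (taylor_norm F r p1) by split=> // -[].
move=> ip; have p0 : 0 < p by exact: (lt_le_trans ltr01 p1).
have := parallelogram_law _ _ _ _ ip
  (witness R F r p p1 r1 1 0) (witness R F r p p1 r1 0 1).
rewrite witnessD witnessB !norm_witness.
rewrite !(addr0, add0r, subr0) normrN normr1 normr0 powR0 ?gt_eqF//.
rewrite !powR1 addr0 add0r !powR1 => h.
move/eqP: p2; apply; apply: powR2_inv_sqr_eq2 => //.
by move: h; rewrite -natr1; lra.
Qed.
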